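(* Let $E$ be a continuous signature, let $X$ be a topological $E$-algebra, let $Y$ be a dense subalgebra of $X$, and let $p,q\in\mathsf T(E)$ be terms. If the identity $p\approx q$ holds for $Y$, then the identity $p\approx q$ holds for $X$.
   Context: All spaces are Tychonoff. A continuous signature is a space $E$ that is the disjoint union of clopen (possibly empty) subsets $E_n$, $n\in\omega=\{0,1,2,\dots\}$. An $E$-algebra is a set $X$ with maps $\mathfrak e^X_n\colon E_n\times X^n\to X$, $n\in\omega$ ($X^0$ is a singleton); for $f\in E_n$ put $f^X(\bar x)=\mathfrak e^X_n(f,\bar x)$. A topological $E$-algebra is an $E$-algebra endowed with a topology making all $\mathfrak e^X_n$ continuous. A subalgebra is a subset closed under all operations $f^X$ (including constants, $f\in E_0$), with the restricted structure. Let $\mathbb V=\{\mathsf v_1,\mathsf v_2,\dots\}$ be a countable set of variables disjoint from $E$. The set $\mathsf T(E)$ of terms is the smallest set containing $\mathbb V\cup E_0$ and such that $f(t_1,\dots,t_m)\in\mathsf T(E)$ whenever $f\in E_m$ and $t_1,\dots,t_m\in\mathsf T(E)$. For a term $t$, $\mathrm{vars}\,t$ is the set of variables occurring in $t$; for $\mathrm{vars}\,t\subset R\subset\mathbb V$ and $\bar x=(x_v)_{v\in R}\in X^R$, $t^X(\bar x)\in X$ is the value of $t$ obtained by substituting $x_v$ for $v$ and evaluating with the operations of $X$. The identity $p\approx q$ holds for $X$ if $p^X(\bar x)=q^X(\bar x)$ for all $\bar x\in X^R$, where $R=\mathrm{vars}\,p\cup\mathrm{vars}\,q$. *)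

(* Defs.v *)
From HB Require Import structures.
From mathcomp Require Import all_boot all_order all_algebra.
From mathcomp Require Import all_classical all_reals all_analysis.

Set Implicit Arguments.
Unset Strict Implicit.
Unset Printing Implicit Defensive.

Local Open Scope classical_set_scope.

(* [uniform_separatorP] relates [completely_regular_space] to separation by
   continuous real-valued functions. *)
Definition tychonoff_space (T : topologicalType) : Prop :=
  hausdorff_space T /\ completely_regular_space T.

Record continuous_signature := ContinuousSignature {
  sig_space :> topologicalType;
  sig_op : nat -> set sig_space;
  sig_tychonoff : tychonoff_space sig_space;
  sig_clopen : forall n, clopen (sig_op n);
  sig_disjoint : trivIset [set: nat] sig_op;
  sig_cover : \bigcup_n sig_op n = [set: sig_space]
}.

Arguments sig_op : clear implicits.

Record algebra (E : continuous_signature) (X : Type) := Algebra {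
  alg_op : forall n, sig_op E n -> ('I_n -> X) -> X
}.

(* [sig_op E n] has the subspace topology, and [{ptws 'I_n -> X}] is the
   product space X^n. *)
Definition topological_algebra (E : continuous_signature)
    (X : topologicalType) (A : algebra E X) : Prop :=
  tychonoff_space X /\
  forall n, continuous
    (fun z : (sig_op E n * {ptws 'I_n -> X})%type => alg_op A z.1 z.2).

Definition subalgebra (E : continuous_signature) (X : Type)
    (A : algebra E X) (Y : set X) : Prop :=
  forall n (f : sig_op E n) (x : 'I_n -> X),
    (forall i, Y (x i)) -> Y (alg_op A f x).

Definition restrict_algebra (E : continuous_signature) (X : Type)
    (A : algebra E X) (Y : set X) (subY : subalgebra A Y) : algebra E Y :=
  Algebra (fun n (f : sig_op E n) (y : 'I_n -> Y) =>
    exist (fun a => a \in Y) (alg_op A f (fun i => \val (y i)))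
      (mem_set (subY n f (fun i => \val (y i)) (fun i => set_valP (y i))))).

(* [Var i] is the variable v_(i+1); a constant c in E_0 is the application of
   c to the empty family of terms. *)
Inductive term (E : continuous_signature) : Type :=
| Var of nat
| App m of sig_op E m & 'I_m -> term E.

Arguments Var {E} _.

Fixpoint vars (E : continuous_signature) (t : term E) : set nat :=
  match t with
  | Var i => [set i]
  | App m f ts => \bigcup_(j : 'I_m) vars (ts j)
  end.

Fixpoint term_eval (E : continuous_signature) (X : Type) (A : algebra E X)
    (R : set nat) (x : R -> X) (t : term E) : vars t `<=` R -> X :=
  match t return vars t `<=` R -> X with
  | Var i => fun tR => x (exist (fun v => v \in R) i (mem_set (tR i erefl)))
  | App m f ts => fun tR =>
      alg_op A f (fun j : 'I_m =>
        @term_eval E X A R x (ts j) (fun v tv => tR v (ex_intro2 _ _ j I tv)))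
  end.

Definition identity_holds (E : continuous_signature) (X : Type)
    (A : algebra E X) (p q : term E) : Prop :=
  forall x : (vars p `|` vars q) -> X,
    term_eval A x (@subsetUl _ (vars p) (vars q)) =
    term_eval A x (@subsetUr _ (vars p) (vars q)).

(* Main.v *)
Require Import Defs.
From mathcomp Require Import all_boot all_order all_algebra.
From mathcomp Require Import all_classical all_reals all_analysis.

Set Implicit Arguments.
Unset Strict Implicit.
Unset Printing Implicit Defensive.

Local Open Scope classical_set_scope.

(** The value of a fixed term depends continuously on the assignment of its variables
    ([term_eval_cvg]), and by density every assignment in [X] is a limit of assignments in [Y] along
    a proper filter ([dense_family_cvg]). Along that filter the values of [p] and [q] agree, so
    their limits agree because [X] is Hausdorff. *)

Lemma cvg_ptws (I T : Type) (X : topologicalType) (F : set_system T)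
    {FF : Filter F} (xs : T -> I -> X) (x : I -> X) :
  (forall i, (fun t => xs t i) @ F --> x i) ->
  (xs : T -> {ptws I -> X}) @ F --> (x : {ptws I -> X}).
Proof.
(* The product topology is the supremum of the topologies pulled back along the projections, so one
   coordinate [i] can be tested at a time. *)
move=> xs_x; apply/cvg_sup => i U [V] [[W oW <-] Wxi] WU.
apply: (filterS WU); apply: xs_x.
exact: open_nbhs_nbhs.
Qed.

(** Induction on [t]: the argument tuples converge in the finite power, and the operation is
    continuous. An arbitrary filter is allowed so that the assignments [xs] can come from [Y]. *)
Lemma term_eval_cvg (E : continuous_signature) (X : topologicalType)
    (A : algebra E X) (T : Type) (F : set_system T) {FF : Filter F}
    (R : set nat) (xs : T -> R -> X) (x : R -> X) (t : term E)
    (tR : vars t `<=` R) :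
  topological_algebra A -> (forall v, (fun y => xs y v) @ F --> x v) ->
  (fun y => term_eval A (xs y) tR) @ F --> term_eval A x tR.
Proof.
move=> [_ cA] xs_x; elim: t tR => [i|m f ts IH] tR /=; first exact: xs_x.
set args := fun y j => term_eval A y
  (fun v tv => tR v (ex_intro2 _ _ j I tv)).
have args_x : (fun y => args (xs y) : {ptws 'I_m -> X}) @ F
    --> (args x : {ptws 'I_m -> X}).
  by apply: cvg_ptws => j; exact: IH.
have pair_x : (fun y => (f, args (xs y) : {ptws 'I_m -> X})) @ F
    --> (f, args x : {ptws 'I_m -> X}).
  exact: (cvg_pair (cvg_cst f) args_x).
exact: cvg_comp pair_x (cA m _).
Qed.

Lemma term_eval_restrict (E : continuous_signature) (X : Type)
    (A : algebra E X) (Y : set X) (subY : subalgebra A Y) (R : set nat)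
    (y : R -> Y) (t : term E) (tR : vars t `<=` R) :
  \val (term_eval (restrict_algebra subY) y tR) =
  term_eval A (fun v => \val (y v)) tR.
Proof.
elim: t tR => [i|m f ts IH] tR //=.
by congr (alg_op A f _); apply/funext => j; exact: IH.
Qed.

(* The filter is the trace on Y^I of the box neighborhoods of x, which is
   proper for any I because Y meets the factors independently. *)
Lemma dense_family_cvg (I : Type) (X : topologicalType) (Y : set X)
    (x : I -> X) :
  dense Y ->
  exists2 F : set_system (I -> Y), ProperFilter F &
    forall i, (fun y => \val (y i)) @ F --> x i.
Proof.
move=> dY.
pose box (U : I -> set X) := [set y : I -> Y | forall i, U i (\val (y i))].
exists (filter_from [set U | forall i, nbhs (x i) (U i)] box).
  apply: filter_from_proper.
    apply: filter_from_filter; first by exists (fun=> setT) => i; exact: filterT.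
    move=> U V xU xV; exists (fun i => U i `&` V i).
      by move=> i; exact: filterI.
    by move=> y UVy; split=> i; have [] := UVy i.
  move=> U xU.
  have /choice[y Uy] : forall i, exists a : Y, U i (\val a).
    move=> i; have := xU i; rewrite nbhsE => -[V [oV Vx] VU].
    have [a [Va Ya]] := dY V (ex_intro _ _ Vx) oV.
    by exists (exist (fun a => a \in Y) a (mem_set Ya)); exact: VU.
  by exists y.
(* This family is [U] at coordinate [i] and all of [X] elsewhere. *)
move=> i U xU; exists (fun j => [set a | j = i -> U a]).
  move=> j /=; have [->|ji] := pselect (j = i).
    by apply: filterS xU => a Ua.
  by apply: filterS (filterT : nbhs (x j) setT) => a _ /ji.
by move=> y yU; exact: (yU i).
Qed.

Theorem theorem9 (E : continuous_signature) (X : topologicalType)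
    (A : algebra E X) (Y : set X) (subY : subalgebra A Y) (p q : term E) :
  topological_algebra A -> dense Y ->
  identity_holds (restrict_algebra subY) p q -> identity_holds A p q.
Proof.
move=> tA dY idY x.
have [F FF Fx] := dense_family_cvg x dY.
have [[hX _] _] := tA.
have eval_cvg t (tR : vars t `<=` vars p `|` vars q) :
    (fun y => \val (term_eval (restrict_algebra subY) y tR)) @ F
    --> term_eval A x tR.
  under eq_fun do rewrite term_eval_restrict.
  exact: term_eval_cvg tA Fx.
have := eval_cvg p (@subsetUl _ (vars p) (vars q)).
(* The identity in [Y] turns the values of [p] into those of [q], which thus converge to the value
   of [p] at [x] as well as to that of [q]. *)
under eq_fun do rewrite idY.
by move=> /(cvg_unique hX); apply; exact: eval_cvg.
Qed.
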